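(* Let $p$ be an odd prime, $l\ge 1$ an integer, $q=p^l$, and let $E\subset \mathbb{Z}_q^2$ with $|E|>p^{2l-\frac{1}{2}}$. Then $|V_2(E)|\geq \frac{q}{4}\cdot\frac{1+p}{p}-1$.
   Context: $\mathbb{Z}_q$ denotes the ring of integers modulo $q$. For $E\subset\mathbb{Z}_q^2$, $V_2(E)=\{\det(x^{1}-x^{3},\,x^{2}-x^{3}) : x^1,x^2,x^3\in E\}\setminus\{0\}$, where $\det(u,v)$ is the determinant of the $2\times 2$ matrix with columns $u,v$, computed in $\mathbb{Z}_q$. *)

(* Defs.v *)
From mathcomp Require Import all_boot all_order all_algebra.

Set Implicit Arguments.
Unset Strict Implicit.
Unset Printing Implicit Defensive.

Import GRing.Theory.
Local Open Scope ring_scope.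

(* 'Z_q is the ring of integers modulo q only for 1 < q. *)
Definition V2 (q : nat) (E : {set 'cV['Z_q]_2}) : {set 'Z_q} :=
  [set d : 'Z_q | [exists x1 in E, exists x2 in E, exists x3 in E,
     d == \det (row_mx (x1 - x3) (x2 - x3) : 'M['Z_q]_2)]] :\ 0.

(* Main.v *)
Require Import Defs.
From mathcomp Require Import all_boot all_order all_algebra.
From mathcomp Require Import reals exp.
From mathcomp Require Import ring lra.

Import Order.TTheory GRing.Theory Num.Theory.
Local Open Scope ring_scope.

(** If x1 - x3 = s (1, t) with s a unit, then x2 |-> det (x1 - x3, x2 - x3) is
    s times a translate of the projection x2 |-> x2_1 - t x2_0 along (1, t), so
    E spans at least as many areas as that projection has values.  Points of E
    on a line of direction (1, t) without unit differences are at most as many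
    as the nonunits, so such x1, x3 exist for every t once #|E| exceeds
    #|A| * #|nonunits|.  Cauchy-Schwarz bounds the number of values of each
    projection from below by its collision count, and the collisions summed
    over t are few: a difference z with z_0 a unit is killed by one t, and all
    the other z together contribute #|A| * #|nonunits| pairs (t, z), because
    z_1 = t z_0. *)

Lemma card_imset_collisions (aT rT : finType) (f : aT -> rT) (E : {set aT}) :
  (#|E| ^ 2 <= #|f @: E| * \sum_(x in E) \sum_(y in E) (f x == f y))%N.
Proof.
pose n b := (\sum_(x in E) (f x == b))%N.
have cardE : #|E| = (\sum_(b in f @: E) n b)%N.
  rewrite exchange_big /= -sum1_card; apply: eq_bigr => x xE.
  rewrite (bigD1 (f x)) ?imset_f //= eqxx big1 // => b /andP[_ /negPf].
  by rewrite eq_sym => ->.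
have -> : (\sum_(x in E) \sum_(y in E) (f x == f y) =
           \sum_(b in f @: E) n b ^ 2)%N.
  transitivity (\sum_(x in E) \sum_(b in f @: E) (f x == b) * n b)%N.
    apply: eq_bigr => x xE.
    rewrite [RHS](bigD1 (f x)) ?imset_f //= eqxx mul1n.
    rewrite [X in (_ + X)%N]big1 ?addn0; last first.
      by move=> b /andP[_ /negPf]; rewrite eq_sym => ->.
    by apply: eq_bigr => y _; rewrite eq_sym.
  rewrite exchange_big; apply: eq_bigr => b _.
  by rewrite -big_distrl /= -/(n b) mulnn.
(* Doubling lets both sides become sums over pairs [(b, c)], compared termwise by
   [2 * (n b * n c) <= n b ^ 2 + n c ^ 2]. *)
rewrite cardE -(leq_pmul2l (isT : (0 < 2)%N)).
have -> : ((\sum_(b in f @: E) n b) ^ 2 =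
           \sum_(b in f @: E) \sum_(c in f @: E) n b * n c)%N.
  by rewrite -mulnn big_distrlr.
have -> : (2 * (#|f @: E| * \sum_(b in f @: E) n b ^ 2) =
  \sum_(b in f @: E) \sum_(c in f @: E) (n b ^ 2 + n c ^ 2))%N.
  under [RHS]eq_bigr do rewrite big_split /= sum_nat_const.
  by rewrite big_split /= sum_nat_const -big_distrr /= addnn mul2n.
rewrite big_distrr /=; apply: leq_sum => b _.
by rewrite big_distrr /=; apply: leq_sum => c _; apply: nat_Cauchy.
Qed.

Section FiniteRing.

Variable A : finComUnitRingType.

Implicit Types (t s : A) (x y z : 'cV[A]_2) (E : {set 'cV[A]_2}).

Definition nonunits : {set A} := [set a | a \isn't a GRing.unit].

(** Zero is kept, so that a full affine image of a projection fits inside; it is removed only at the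
    end. *)
Definition areas E : {set A} :=
  [set d : A | [exists x1 in E, exists x2 in E, exists x3 in E,
     d == \det (row_mx (x1 - x3) (x2 - x3) : 'M[A]_2)]].

(** The fibres are the lines of direction [(1, t)]. *)
Definition slope_proj t x : A := x 1 0 - t * x 0 0.

Lemma slope_projB t x y :
  slope_proj t (x - y) = slope_proj t x - slope_proj t y.
Proof. by rewrite /slope_proj !mxE; ring. Qed.

Lemma det_mx22 (M : 'M[A]_2) : \det M = M 0 0 * M 1 1 - M 0 1 * M 1 0.
Proof.
rewrite (expand_det_row _ 0) !big_ord_recl big_ord0 /cofactor !det_mx11 !mxE.
rewrite (_ : lift 0 0 = 1); last exact/val_inj.
rewrite (_ : lift 1 0 = 0); last exact/val_inj.
by rewrite /=; ring.
Qed.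

Lemma det_row_cV2 x y :
  \det (row_mx x y : 'M[A]_2) = x 0 0 * y 1 0 - y 0 0 * x 1 0.
Proof.
have elt0 i : (row_mx x y : 'M[A]_2) i 0 = x i 0.
  by rewrite -[RHS](row_mxEl x y); congr (row_mx x y i _); apply/val_inj.
have elt1 i : (row_mx x y : 'M[A]_2) i 1 = y i 0.
  by rewrite -[RHS](row_mxEr x y); congr (row_mx x y i _); apply/val_inj.
by rewrite det_mx22 !elt0 !elt1.
Qed.

Lemma cV2P x y : x 0 0 = y 0 0 -> x 1 0 = y 1 0 -> x = y.
Proof.
move=> e0 e1; apply/matrixP => i j; rewrite (ord1 j).
case: i => [[|[|//]] lti].
  by rewrite (_ : Ordinal lti = 0) //; apply/val_inj.
by rewrite (_ : Ordinal lti = 1) //; apply/val_inj.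
Qed.

Lemma slope_proj_fiber_inj t x y :
  slope_proj t x = slope_proj t y -> x 0 0 = y 0 0 -> x = y.
Proof.
move=> + e; rewrite /slope_proj e => /addIr e1; exact: cV2P.
Qed.

(** Pigeonhole over the [#|A|] fibres: in a fibre without unit differences, subtracting the first
    coordinate of a fixed point [y] embeds the fibre into the nonunits. *)
Lemma exists_unit_difference E t : (#|A| * #|nonunits| < #|E|)%N ->
  exists x, exists y, [/\ x \in E, y \in E, slope_proj t x = slope_proj t y &
    x 0 0 - y 0 0 \is a GRing.unit].
Proof.
move=> bigE.
have [/existsP[x /existsP[y /and4P[xE yE /eqP e u]]]|none] :=
  boolP [exists x, exists y, [&& x \in E, y \in E,
    slope_proj t x == slope_proj t y & x 0 0 - y 0 0 \is a GRing.unit]].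
  by exists x, y.
suff: (#|E| <= #|A| * #|nonunits|)%N by rewrite leqNgt bigE.
rewrite -sum1_card (partition_big (slope_proj t) xpredT) //=.
rewrite -sum_nat_const; apply: leq_sum => b _.
rewrite sum1_card.
set F := [pred x in E | slope_proj t x == b].
have [/eqP|] := boolP (#|F| == 0)%N; first by rewrite /F => ->.
rewrite -lt0n => /card_gt0P[y /andP[yE /eqP yb]].
rewrite -/F -(card_in_imset (f := fun x => x 0 0 - y 0 0)); last first.
  move=> x z /andP[_ /eqP xb] /andP[_ /eqP zb] /addIr e.
  by apply: (slope_proj_fiber_inj t) => //; rewrite xb zb.
apply/subset_leq_card/subsetP => _ /imsetP[x /andP[xE /eqP xb] ->].
rewrite inE; apply: contra none => u.
by apply/existsP; exists x; apply/existsP; exists y; rewrite xE yE xb yb eqxx.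
Qed.

Lemma card_slope_proj_areas E t : (#|A| * #|nonunits| < #|E|)%N ->
  (#|slope_proj t @: E| <= #|areas E|)%N.
Proof.
move=> /(exists_unit_difference E t)[x1 [x3 [x1E x3E e u]]].
(* This affine map sends [slope_proj t x2] to the determinant, and is injective since its leading
   factor is a unit. *)
pose g d := (x1 0 0 - x3 0 0) * (d - slope_proj t x3).
rewrite -(card_imset _ (f := g)); last by move=> d d' /(mulrI u)/addIr.
apply/subset_leq_card/subsetP => _ /imsetP[_ /imsetP[x2 x2E ->] ->].
rewrite inE; apply/existsP; exists x1; rewrite x1E; apply/existsP; exists x2.
rewrite x2E; apply/existsP; exists x3; rewrite x3E /=; apply/eqP.
have e1 : x1 1 0 - x3 1 0 = t * (x1 0 0 - x3 0 0).
  by move/eqP: e; rewrite -subr_eq0 -slope_projB subr_eq0 !mxE => /eqP.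
by rewrite det_row_cV2 !mxE e1 /g /slope_proj; ring.
Qed.

Lemma sum_slope_proj_unit z : z 0 0 \is a GRing.unit ->
  (\sum_t (slope_proj t z == 0%R) <= 1)%N.
Proof.
move=> u; rewrite (bigD1 (z 1 0 / z 0 0)) //= big1 ?addn0 ?leq_b1 //.
move=> t /eqP ne; case: eqP => // /subr0_eq e.
by case: ne; rewrite e mulrK.
Qed.

Lemma sum_slope_proj_nonunit t :
  (\sum_(z : 'cV[A]_2 | z 0%R 0%R \isn't a GRing.unit) (slope_proj t z == 0%R)
    <= #|nonunits|)%N.
Proof.
rewrite -big_mkcondr sum1_card -(card_in_imset (f := fun z => z 0 0)).
  by apply/subset_leq_card/subsetP => _ /imsetP[z /andP[nu _] ->]; rewrite inE.
move=> x y /andP[_ /eqP x0] /andP[_ /eqP y0].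
by apply: (slope_proj_fiber_inj t); rewrite x0 y0.
Qed.

Lemma sum_slope_collisions E :
  (\sum_t \sum_(x in E) \sum_(y in E) (slope_proj t x == slope_proj t y)
    <= #|E| ^ 2 + #|E| * (#|A| * #|nonunits|))%N.
Proof.
rewrite exchange_big /= -mulnn -mulnDr -sum_nat_const.
apply: leq_sum => x xE; rewrite exchange_big /=.
(* For fixed [x], each [y] at unit difference collides for at most one [t], giving [#|E|] in all;
   for the other [y], the nonunits bound the collisions at each [t]. *)
rewrite (bigID (fun y => x 0 0 - y 0 0 \is a GRing.unit)) /=.
have collE t y : (slope_proj t x == slope_proj t y) = (slope_proj t (x - y) == 0).
  by rewrite slope_projB subr_eq0.
under eq_bigr do under eq_bigr do rewrite collE.
under [X in (_ + X)%N]eq_bigr do under eq_bigr do rewrite collE.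
apply: leq_add.
  rewrite -sum1_card big_mkcondr /=; apply: leq_sum => y _; case: ifP => // u.
  by apply: sum_slope_proj_unit; rewrite !mxE.
rewrite exchange_big /= -sum_nat_const; apply: leq_sum => t _.
apply: leq_trans (sum_slope_proj_nonunit t).
(* Substitute [z = x - y] with [y] ranging over the whole plane, then restrict to [y] in [E]. *)
rewrite [leqRHS](reindex_inj (inj_comp (addrI x) oppr_inj)) /=.
rewrite big_mkcond [leqRHS]big_mkcond /=; apply: leq_sum => y _.
by rewrite !mxE; case: (y \in E) => //=; case: ifP.
Qed.

Theorem card_areas E : (#|A| * #|nonunits| < #|E|)%N -> (#|A| <= 2 * #|areas E|)%N.
Proof.
move=> bigE; have E0 : (0 < #|E|)%N by apply: leq_trans bigE.
(* Summing Cauchy-Schwarz over all [t] bounds [#|A| * #|E| ^ 2] by [#|areas E|] times the total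
   collisions, which [bigE] keeps below [2 * #|E| ^ 2]. *)
rewrite -(@leq_pmul2r (#|E| ^ 2)) ?expn_gt0 ?E0 //.
have le_sum : (#|A| * #|E| ^ 2 <= #|areas E| *
   \sum_t \sum_(x in E) \sum_(y in E) (slope_proj t x == slope_proj t y))%N.
  rewrite -[leqLHS]sum_nat_const [leqRHS]big_distrr /=; apply: leq_sum => t _.
  apply: leq_trans (card_imset_collisions _ _ (slope_proj t) E) _.
  by rewrite leq_mul2r card_slope_proj_areas ?orbT.
apply: (leq_trans le_sum); rewrite (mulnC 2%N) -mulnA leq_mul2l.
apply/orP; right; apply: leq_trans (sum_slope_collisions E) _.
by rewrite mul2n -addnn leq_add2l -mulnn leq_mul2l (ltnW bigE) orbT.
Qed.

End FiniteRing.

Lemma card_nonunits_Zp_pfactor (p l : nat) : prime p ->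
  #|nonunits 'Z_(p ^ l.+1)| = (p ^ l)%N.
Proof.
move=> pr_p; have q_gt1 : (1 < p ^ l.+1)%N.
  by rewrite -(exp1n l.+1) ltn_exp2r // prime_gt1.
have -> : nonunits 'Z_(p ^ l.+1) = ~: [set a | a \is a GRing.unit].
  by apply/setP => a; rewrite !inE.
rewrite cardsCs setCK card_ord Zp_cast //.
have -> : #|[set a : 'Z_(p ^ l.+1) | a \is a GRing.unit]| = totient (p ^ l.+1).
  rewrite -card_units_Zp ?(ltnW q_gt1) // -(card_imset _ val_inj) /=.
  apply: eq_card => a; rewrite inE; apply/idP/imsetP => [ua|[u _ ->]].
    by exists (FinRing.unit _ ua); rewrite ?inE.
  exact: valP.
(* The count is [p * p ^ l - p.-1 * p ^ l]. *)
rewrite totient_pfactor //= expnS.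
by move: (prime_gt0 pr_p); case: p {pr_p q_gt1} => // p _ /=; rewrite mulSn addnK.
Qed.

Theorem theorem1p2 (R : realType) (p l q : nat)
  (p_prime : prime p) (p_odd : odd p) (l_ge1 : (1 <= l)%N)
  (qE : q = (p ^ l)%N) (E : {set 'cV['Z_q]_2})
  (E_large : (p%:R : R) `^ (2 * l%:R - 1 / 2) < #|E|%:R) :
  (q%:R / 4 * ((1 + p%:R) / p%:R) - 1 : R) <= #|V2 E|%:R.
Proof.
have p0 := prime_gt0 p_prime.
have q_gt1 : (1 < q)%N.
  by rewrite qE -(exp1n l) ltn_exp2r // prime_gt1.
have cardZ : #|'Z_q| = q by rewrite card_ord Zp_cast.
have nonunitsE : #|nonunits 'Z_q| = (p ^ l.-1)%N.
  by case: l l_ge1 qE {E_large} => // l _ ->; apply: card_nonunits_Zp_pfactor.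
have bigE : (#|'Z_q| * #|nonunits 'Z_q| < #|E|)%N.
  (* The threshold is [p ^ (2l - 1)], below the assumed [p ^ (2l - 1/2)]. *)
  rewrite cardZ nonunitsE [X in (X * _)%N]qE -expnD -(ltr_nat R) natrX.
  apply: le_lt_trans E_large; rewrite -powR_mulrn ?ler0n //.
  apply: ler_powR; first by rewrite ler1n.
  case: l l_ge1 {qE nonunitsE} => // l _ /=.
  by rewrite natrD -natr1; lra.
have half := card_areas _ E bigE.
(* Discarding the zero area costs at most one, hence the [- 1] in the bound. *)
have areasV : (#|areas _ E| <= #|V2 E|.+1)%N.
  by rewrite -[V2 E]/(areas _ E :\ 0) (cardsD1 0) -add1n leq_add2r leq_b1.
have qV : q%:R <= 2 * (#|V2 E|%:R + 1) :> R.
  rewrite -[X in X%:R <= _]cardZ natr1 -natrM ler_nat (leq_trans half) //.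
  by rewrite leq_mul2l areasV.
have pR1 : 1 <= p%:R :> R by rewrite ler1n.
(* As [(1 + p) / p <= 2], the claim follows from the bound [q / 2 - 1]. *)
have ratio : (1 + p%:R) / p%:R <= 2 :> R by rewrite ler_pdivrMr; lra.
have : q%:R / 4 * ((1 + p%:R) / p%:R) <= q%:R / 4 * 2 :> R.
  by rewrite ler_wpM2l // divr_ge0.
lra.
Qed.
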